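(* Let $f:X\to Y$ be a map between uniform spaces with $Y$ Hausdorff. Then the following are equivalent. 1. There is a strong Mittag-Leffler inverse system of uniform spaces $\{X_\alpha,\phi_{\beta\alpha}\}$ and compatible uniform covering maps $f_\alpha:X_\alpha\to Y$ with $f=\varprojlim f_\alpha$, i.e. there is a uniform equivalence $\Phi:X\to\varprojlim X_\alpha$ with $(\varprojlim f_\alpha)\circ\Phi=f$. 2. $X$ is Hausdorff and $f$ generates the uniform structure on $Y$, has chain lifting, has strong approximate uniqueness of chain lifts, and has complete fibers.
   Context: For a function $f:X\to Y$ and $E\subset X\times X$ put $f(E)=\{(f(x),f(y)):(x,y)\in E\}$. For uniform spaces $X,Y$, $f$ generates the uniform structure on $Y$ if $\{f(E): E \text{ an entourage of } X\}$ is a basis of that structure (equivalently, $f$ is uniformly continuous and the image of every entourage of $X$ is an entourage of $Y$). For $E\subset X\times X$, an $E$-chain is a finite sequence $x_1,\ldots,x_n$ with $(x_i,x_{i+1})\in E$ for all $i<n$. Two chains $x_1,\ldots,x_n$ and $y_1,\ldots,y_n$ are $E$-close if $(x_i,y_i)\in E$ for all $i\le n$. Images of chains are taken termwise. - $f$ has chain lifting if for every entourage $E$ of $X$ there is an entourage $F$ of $X$ such that for every $x\in X$, any $f(F)$-chain in $Y$ starting at $f(x)$ lifts (termwise under $f$) to an $E$-chain in $X$ starting at $x$. - $f$ has uniqueness of chain lifts if for every entourage $E$ of $X$ there is an entourage $F\subset E$ such that any two $F$-chains in $X$ starting at the same point with identical images under $f$ are equal. - $f$ is a uniform covering map if it generates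 the uniform structure on $Y$ and has chain lifting and uniqueness of chain lifts. - $f$ has strong approximate uniqueness of chain lifts if for every entourage $E$ of $X$ there is an entourage $F\subset E$ such that any two $F$-chains in $X$ starting at the same point with identical images under $f$ are $F$-close. - $f$ has complete fibers if each $f^{-1}(y)$, $y\in Y$, is complete in the subspace uniform structure. Inverse systems are indexed by nonempty directed index sets; $\beta<\alpha$ is the (reflexive) direction relation, any two indices have a common $\beta$ below both, and for $\beta<\alpha$ the bonding map $\phi_{\beta\alpha}:X_\beta\to X_\alpha$ is uniformly continuous. $\varprojlim X_\alpha$ has the inverse limit uniform structure, with basis the sets $\pi_\alpha^{-1}(E_\alpha)$, $E_\alpha$ an entourage of $X_\alpha$, where $\pi_\alpha$ is the projection to $X_\alpha$. The system is strong Mittag-Leffler if for each $\alpha$ there is $\beta<\alpha$ with $\phi_{\beta\alpha}(X_\beta)\subset\pi_\alpha(\varprojlim X_\alpha)$. Maps $f_\alpha:X_\alpha\to Y$ are compatible if $f_\alpha\circ\phi_{\beta\alpha}=f_\beta$ for $\beta<\alpha$; then $\varprojlim f_\alpha:\varprojlim X_\alpha\to Y$ sends $(x_\alpha)$ to the common value $f_\alpha(x_\alpha)$. A uniform equivalence is a bijection that is uniformly continuous in both directions. *)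

(* Defs.v *)
From HB Require Import structures.
From mathcomp Require Import all_boot all_classical.
From mathcomp Require Import topology_structure uniform_structure.
From mathcomp Require Import initial_topology subtype_topology separation_axioms.

Set Implicit Arguments.
Unset Strict Implicit.
Unset Printing Implicit Defensive.

Local Open Scope classical_set_scope.

Definition pair_image {X Y : Type} (f : X -> Y) (E : set (X * X)) :
  set (Y * Y) := [set (f p.1, f p.2) | p in E].

(* [filter_from B g] is the family of all supersets of the sets [g E], E in B:
   the equality says that the images of the entourages of X are a basis of the
   uniform structure of Y. *)
Definition generates_uniformity {X Y : uniformType} (f : X -> Y) : Prop :=
  @entourage Y = filter_from (@entourage X) (pair_image f).

Definition is_chain {X : Type} (E : set (X * X)) (s : seq X) : bool :=
  sorted (fun x y => (x, y) \in E) s.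

(* [all2] is false on sequences of different lengths. *)
Definition close_chains {X : Type} (E : set (X * X)) (s t : seq X) : bool :=
  all2 (fun x y => (x, y) \in E) s t.

Definition chain_lifting {X Y : uniformType} (f : X -> Y) : Prop :=
  forall E : set (X * X), entourage E ->
  exists2 F : set (X * X), entourage F &
    forall (x : X) (t : seq Y), is_chain (pair_image f F) (f x :: t) ->
    exists2 s : seq X, is_chain E (x :: s) & map f (x :: s) = f x :: t.

Definition uniqueness_of_chain_lifts {X Y : uniformType} (f : X -> Y) : Prop :=
  forall E : set (X * X), entourage E ->
  exists F : set (X * X), [/\ entourage F, F `<=` E &
    forall (x : X) (s t : seq X), is_chain F (x :: s) -> is_chain F (x :: t) ->
    map f (x :: s) = map f (x :: t) -> x :: s = x :: t].

Definition strong_approx_uniqueness_of_chain_lifts {X Y : uniformType}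
    (f : X -> Y) : Prop :=
  forall E : set (X * X), entourage E ->
  exists F : set (X * X), [/\ entourage F, F `<=` E &
    forall (x : X) (s t : seq X), is_chain F (x :: s) -> is_chain F (x :: t) ->
    map f (x :: s) = map f (x :: t) -> close_chains F (x :: s) (x :: t)].

Definition uniform_covering_map {X Y : uniformType} (f : X -> Y) : Prop :=
  [/\ generates_uniformity f, chain_lifting f & uniqueness_of_chain_lifts f].

(* The library's [completeType] is restricted to pointed spaces. *)
Definition complete_space (X : uniformType) : Prop :=
  forall F : set_system X, ProperFilter F -> cauchy F ->
  exists x : X, F --> x.

(* The type [set_type A] carries the uniform structure induced by its inclusion
   into the ambient space. *)
Definition complete_fibers {X Y : uniformType} (f : X -> Y) : Prop :=
  forall y : Y, complete_space (set_type (f @^-1` [set y])).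

Definition uniform_equivalence {X Y : uniformType} (f : X -> Y) : Prop :=
  exists g : Y -> X,
    [/\ cancel f g, cancel g f, unif_continuous f & unif_continuous g].

(* [dir_le b a] is the direction relation b < a (reflexive), so [bonding] goes
   from the space at b to the space at a.  The index [dir_point] only witnesses
   that the index set is nonempty. *)
Record inverse_system := InverseSystem {
  dir_index :> Type;
  dir_le : dir_index -> dir_index -> Prop;
  dir_point : dir_index;
  dir_le_refl : forall a, dir_le a a;
  dir_le_trans : forall c b a, dir_le c b -> dir_le b a -> dir_le c a;
  dir_le_directed : forall a b, exists c, dir_le c a /\ dir_le c b;
  sys_space : dir_index -> uniformType;
  bonding : forall b a, dir_le b a -> sys_space b -> sys_space a;
  bonding_unif_continuous : forall b a (h : dir_le b a),
    unif_continuous (bonding h);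
  bonding_id : forall a (h : dir_le a a) x, bonding h x = x;
  bonding_comp : forall c b a (hcb : dir_le c b) (hba : dir_le b a)
    (hca : dir_le c a) x, bonding hba (bonding hcb x) = bonding hca x
}.

Record inverse_limit (S : inverse_system) := InverseLimit {
  lim_proj : forall a : S, sys_space a;
  lim_projP : forall (b a : S) (h : dir_le b a),
    bonding h (lim_proj b) = lim_proj a
}.

Definition lim_entourage (S : inverse_system) :
    set_system (inverse_limit S * inverse_limit S) :=
  [set D | exists (a : S) (E : set (sys_space a * sys_space a)), entourage E /\
    [set p | E (lim_proj p.1 a, lim_proj p.2 a)] `<=` D].

Section inverse_limit_uniform.
Local Open Scope relation_scope.
Variable S : inverse_system.
Notation L := (inverse_limit S).

Let bonding_entourage (b a : S) (h : dir_le b a)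
    (E : set (sys_space a * sys_space a)) : entourage E ->
  entourage [set p | E (bonding h p.1, bonding h p.2)].
Proof. by move=> /(bonding_unif_continuous h). Qed.

Let lim_entourage_filter : Filter (@lim_entourage S).
Proof.
split.
- by exists (dir_point S), setT; split => //; exact: entourageT.
- move=> P Q [a [E [entE EP]]] [b [G [entG GQ]]].
  have [c [hca hcb]] := dir_le_directed a b.
  exists c, ([set p | E (bonding hca p.1, bonding hca p.2)] `&`
             [set p | G (bonding hcb p.1, bonding hcb p.2)]); split.
    by apply: filterI; exact: bonding_entourage.
  by move=> p /= []; rewrite !lim_projP => Ep Gp; split; [exact: EP|exact: GQ].
- move=> P Q PQ [a [E [entE EP]]]; exists a, E; split => //.
  exact: subset_trans PQ.
Qed.

Let lim_entourage_diagonal (D : set (L * L)) :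
  lim_entourage D -> diagonal `<=` D.
Proof.
move=> [a [E [entE ED]]] [x y] xy; apply: ED.
by rewrite /= (_ : x = y) //; exact: entourage_refl.
Qed.

Let lim_entourage_inv (D : set (L * L)) :
  lim_entourage D -> lim_entourage D^-1.
Proof.
move=> [a [E [entE ED]]]; exists a, (E^-1); split.
  exact: entourage_inv.
by move=> [x y] /= Exy; apply: (ED (y, x)).
Qed.

Let lim_entourage_split (D : set (L * L)) : lim_entourage D ->
  exists2 B, lim_entourage B & B \; B `<=` D.
Proof.
move=> [a [E [entE ED]]].
exists [set p | split_ent E (lim_proj p.1 a, lim_proj p.2 a)].
  by exists a, (split_ent E); split => //; exact: entourage_split_ent.
move=> [x z] /= [y /= xy yz]; apply: ED => /=.
exact: entourage_split xy yz.
Qed.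

HB.instance Definition _ := gen_eqMixin L.
HB.instance Definition _ := gen_choiceMixin L.
HB.instance Definition _ := @isUniform.Build L (@lim_entourage S)
  lim_entourage_filter lim_entourage_diagonal lim_entourage_inv
  lim_entourage_split.

End inverse_limit_uniform.

Definition strong_Mittag_Leffler (S : inverse_system) : Prop :=
  forall a : S, exists (b : S) (h : dir_le b a),
    range (bonding h) `<=` range (fun x : inverse_limit S => lim_proj x a).

Definition compatible_maps (S : inverse_system) (Y : Type)
    (fa : forall a : S, sys_space a -> Y) : Prop :=
  forall (b a : S) (h : dir_le b a) (x : sys_space b),
    fa a (bonding h x) = fa b x.

Definition lim_map (S : inverse_system) (Y : Type)
    (fa : forall a : S, sys_space a -> Y) (x : inverse_limit S) : Y :=
  fa (dir_point S) (lim_proj x (dir_point S)).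

(* For compatible maps the choice of the index in [lim_map] is immaterial. *)
Lemma lim_mapE (S : inverse_system) (Y : Type)
    (fa : forall a : S, sys_space a -> Y) (x : inverse_limit S) (a : S) :
  compatible_maps fa -> lim_map fa x = fa a (lim_proj x a).
Proof.
move=> fac; have [c [hc ha]] := dir_le_directed (dir_point S) a.
by rewrite /lim_map -(lim_projP x hc) -(lim_projP x ha) !fac.
Qed.

(* Main.v *)
(* All the chain conditions reduce to conditions on single steps.  Given a
   system of coverings, an entourage of the limit comes from one coordinate a,
   and by the strong Mittag-Leffler condition there is b < a such that points of
   X_b, pushed to X_a, come from X; generation and lifting for f_b thus pass to
   f, and uniqueness for f_a passes directly.  A Cauchy filter on a fiber is
   eventually constant in every X_a, hence converges to a thread.
   Conversely, strong approximate uniqueness makes the symmetric entourages F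
   that are stable under lifting a basis of X.  For such F the relation
   "f x = f y and (x, y) in F" is an equivalence; with the images of the
   entourages of X its quotient X_F is a uniform space covering Y, and X is the
   limit of the X_F: separatedness gives injectivity of X -> lim X_F and
   completeness of the fibers gives surjectivity. *)
From HB Require Import structures.
Require Import Defs.
From mathcomp Require Import all_boot all_classical.
From mathcomp Require Import topology_structure uniform_structure.
From mathcomp Require Import separation_axioms.

Set Implicit Arguments.
Unset Strict Implicit.
Unset Printing Implicit Defensive.

Local Open Scope classical_set_scope.

(** * Entourage criteria and single-step forms of the chain conditions *)

Lemma hausdorff_entourageP (X : uniformType) :
  hausdorff_space X <->
  forall x y : X, (forall E, entourage E -> E (x, y)) -> x = y.
Proof.
split=> [hX x y Exy|hX x y xy].
  apply: hX => A B; rewrite -!nbhs_entourageE => -[E entE EA] [D entD DB].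
  exists y; split; first by apply: EA; apply/xsectionP; exact: Exy.
  by apply: DB; apply/xsectionP; exact: entourage_refl.
apply: hX => E entE; set D := split_ent E.
have entD : entourage D by exact: entourage_split_ent.
have xD : nbhs x (xsection D x) by exact: nbhs_entourage.
have yD : nbhs y (xsection (D^-1)%relation y).
  by apply: nbhs_entourage; exact: entourage_inv.
have [z [/xsectionP xz /xsectionP zy]] := xy _ _ xD yD.
exact: entourage_split xz zy.
Qed.

(** A chain lifts one step at a time: the end [x'] of the lifted first step is the start over which
    the rest is lifted, so the same [F] serves both forms. *)
Lemma chain_liftingP (X Y : uniformType) (f : X -> Y) :
  chain_lifting f <->
  forall E : set (X * X), entourage E ->
  exists2 F : set (X * X), entourage F &
    forall x y, pair_image f F (f x, y) -> exists2 x', E (x, x') & f x' = y.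
Proof.
split=> lf E entE; have [F entF FE] := lf E entE; exists F => //.
  move=> x y xy; have [|s] := FE x [:: y].
    by rewrite /is_chain /= mem_set.
  case: s => [|x' [|? ?]] //=; rewrite /is_chain /= andbT => /set_mem Exx' [<-].
  by exists x'.
move=> x t; elim: t x => [|y t IHt] x; first by exists [::].
rewrite /is_chain /= => /andP[/set_mem /FE[x' Exx' <-]] /IHt[s Es [fs]].
exists (x' :: s); last by rewrite /= fs.
by rewrite /is_chain /=; apply/andP; split => //; exact: mem_set.
Qed.

Lemma uniqueness_of_chain_liftsP (X Y : uniformType) (f : X -> Y) :
  uniqueness_of_chain_lifts f <->
  forall E : set (X * X), entourage E ->
  exists F : set (X * X), [/\ entourage F, F `<=` E &
    forall x y z, F (x, y) -> F (x, z) -> f y = f z -> y = z].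
Proof.
split=> uf E entE; have [F [entF FE uF]] := uf E entE; exists F; split => //.
  move=> x y z xy xz fyz; have := uF x [:: y] [:: z].
  by rewrite /is_chain /= fyz !mem_set // => /(_ isT isT erefl)[].
move=> x s; elim: s x => [|y s IHs] x [|z t] //.
rewrite /is_chain /= => /andP[/set_mem xy ys] /andP[/set_mem xz zt] [fyz fst].
have yz := uF _ _ _ xy xz fyz; rewrite -yz in zt *.
by have := IHs y t ys zt; rewrite /= fst => /(_ erefl)[->].
Qed.

(** This is the inductive step of strong approximate uniqueness: [F] bounds both the steps of the
    chains and the distance between them, so closeness does not degrade along a chain. *)
Definition lift_stable (X Y : Type) (f : X -> Y) (F : set (X * X)) : Prop :=
  forall a a' b c, F (a, a') -> f a = f a' -> F (a, b) -> F (a', c) ->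
  f b = f c -> F (b, c).

Lemma strong_approx_uniqueness_of_chain_liftsP (X Y : uniformType)
    (f : X -> Y) :
  strong_approx_uniqueness_of_chain_lifts f <->
  forall E : set (X * X), entourage E ->
  exists F : set (X * X), [/\ entourage F, F `<=` E & lift_stable f F].
Proof.
split=> uf E entE; have [F [entF FE uF]] := uf E entE; exists F; split => //.
  move=> a a' b c aa' faa' ab a'c fbc.
  have chain x y z : F (x, y) -> F (y, z) -> is_chain F [:: x; y; z].
    by move=> xy yz; rewrite /is_chain /= !mem_set.
  have aa := entourage_refl a entF.
  (* The chains [a, a, b] and [a, a', c] have a common start and the same image; their last entries
     give the claim. *)
  have := uF a _ _ (chain _ _ _ aa ab) (chain _ _ _ aa' a'c).
  by rewrite /= faa' fbc => /(_ erefl) /and4P[_ _ /set_mem].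
(* For the induction the common start is relaxed to two [F]-close starts in one fiber. *)
suff close a a' s t : F (a, a') -> f a = f a' ->
    is_chain F (a :: s) -> is_chain F (a' :: t) -> map f s = map f t ->
    close_chains F (a :: s) (a' :: t).
  by move=> x s t xs xt [fst]; apply: close => //; exact: entourage_refl.
rewrite /is_chain /close_chains.
elim: s a a' t => [|b s IHs] a a' [|c t] //= aa' faa'; first by rewrite mem_set.
move=> /andP[/set_mem ab bs] /andP[/set_mem a'c ct] [fbc fst].
by rewrite mem_set //=; apply: IHs => //; exact: uF aa' faa' ab a'c fbc.
Qed.

Lemma generates_uniformityP (X Y : uniformType) (f : X -> Y) :
  generates_uniformity f <->
  unif_continuous f /\ forall E, entourage E -> entourage (pair_image f E).
Proof.
split=> [gf|[cf of_]].
  split=> [G|E entE]; last by rewrite gf; exists E.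
  rewrite gf => -[E entE EG]; apply: filterS entE => p Ep.
  by apply: EG; exists p.
apply/seteqP; split=> G.
  move=> /cf entG; exists [set p | G (f p.1, f p.2)] => //.
  by move=> _ [p Gp <-].
by move=> [E /of_ entE EG]; exact: filterS entE.
Qed.

Lemma cauchyP (X : uniformType) (F : set_system X) : Filter F ->
  cauchy F <-> forall E, entourage E ->
  exists2 A, F A & forall x y, A x -> A y -> E (x, y).
Proof.
move=> FF; split=> cF E entE.
  have [[A B] /= [FA FB] ABE] := cF E entE.
  by exists (A `&` B); [exact: filterI|move=> x y [Ax _] [_ By]; exact: ABE].
by have [A FA AE] := cF E entE; exists (A, A) => // -[x y] [Ax Ay]; exact: AE.
Qed.

Lemma inverse_limit_eq (S : inverse_system) (u v : inverse_limit S) :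
  (forall a, lim_proj u a = lim_proj v a) -> u = v.
Proof.
case: u v => [u hu] [v hv] /= uv.
have {}uv : u = v by exact: functional_extensionality_dep.
by case: _ / uv hv => hv; congr InverseLimit; exact: Prop_irrelevance.
Qed.

(** * Limits of strong Mittag-Leffler systems of coverings *)

Section limit_of_coverings.
Variables (X Y : uniformType) (S : inverse_system).
Variables (fa : forall a : S, sys_space a -> Y) (Phi : X -> inverse_limit S).
Arguments fa : clear implicits.
Hypothesis hY : hausdorff_space Y.
Hypothesis ML : strong_Mittag_Leffler S.
Hypothesis fac : compatible_maps fa.
Hypothesis fcov : forall a, uniform_covering_map (fa a).
Hypothesis PhiE : uniform_equivalence Phi.

Let f := lim_map fa \o Phi.
Let p (a : S) (x : X) : sys_space a := lim_proj (Phi x) a.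
Let pull (a : S) (E : set (sys_space a * sys_space a)) : set (X * X) :=
  [set xy | E (p a xy.1, p a xy.2)].

Let fE a x : f x = fa a (p a x).
Proof. exact: lim_mapE. Qed.

Let entourage_pull a (E : set (sys_space a * sys_space a)) :
  entourage E -> entourage (pull E).
Proof.
move=> entE; have [g [_ _ cPhi _]] := PhiE.
apply: (cPhi [set q | E (lim_proj q.1 a, lim_proj q.2 a)]).
by exists a, E; split.
Qed.

Let pull_basis (E : set (X * X)) : entourage E ->
  exists a (Ea : set (sys_space a * sys_space a)),
    entourage Ea /\ pull Ea `<=` E.
Proof.
move=> entE; have [g [PhiK _ _ cg]] := PhiE.
have [a [Ea [entEa EaE]]] := cg _ entE; exists a, Ea; split => //.
by move=> [x y] xy; have := EaE (Phi x, Phi y) xy; rewrite /= !PhiK.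
Qed.

Let p_bonding b a (h : dir_le b a) x : bonding h (p b x) = p a x.
Proof. exact: lim_projP. Qed.

Let thread_lift (t : forall a : S, sys_space a) :
  (forall b a (h : dir_le b a), bonding h (t b) = t a) ->
  exists x, forall a, p a x = t a.
Proof.
move=> ht; have [g [_ gK _ _]] := PhiE.
by exists (g (InverseLimit ht)) => a; rewrite /p gK.
Qed.

Let p_lift a : exists (b : S) (h : dir_le b a),
  forall u, exists x, p a x = bonding h u.
Proof.
have [b [h hb]] := ML a; exists b, h => u.
have [t _ <-] := hb _ (imageT _ u).
have [x xt] := thread_lift (fun c d (k : dir_le c d) => lim_projP t k).
by exists x.
Qed.

(** Applied with [u = v], this says that the fibers of [fa a] are uniformly discrete: [F]-close
    points of one fiber coincide. *)
Let separating a : exists2 F : set (sys_space a * sys_space a), entourage F &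
  forall u v w, F (u, v) -> F (u, w) -> fa a v = fa a w -> v = w.
Proof.
have [_ _ /uniqueness_of_chain_liftsP ua] := fcov a.
by have [F [entF _ uF]] := ua _ entourageT; exists F.
Qed.

Lemma lim_covering_hausdorff : hausdorff_space X.
Proof.
apply/hausdorff_entourageP => x y xy.
have fxy : f x = f y.
  apply: (hausdorff_entourageP Y).1 => // G entG.
  have a := dir_point S; have [/generates_uniformityP[cf _] _ _] := fcov a.
  by rewrite !(fE a); exact: (xy _ (entourage_pull (cf _ entG))).
have [g [PhiK _ _ _]] := PhiE.
rewrite -(PhiK x) -(PhiK y); congr g.
apply: inverse_limit_eq => a; have [F entF uF] := separating a.
apply: (uF (p a x)); [exact: entourage_refl| |by rewrite -!fE].
exact: (xy _ (entourage_pull entF)).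
Qed.

Lemma lim_covering_generates : generates_uniformity f.
Proof.
apply/generates_uniformityP; split=> [G entG|E entE].
  have a := dir_point S; have [/generates_uniformityP[cf _] _ _] := fcov a.
  by apply: filterS (entourage_pull (cf _ entG)) => -[x y]; rewrite /= !(fE a).
have [a [Ea [entEa EaE]]] := pull_basis entE.
(* Not every point of [sys_space a] need come from [X], so [Ea] is pulled back to [sys_space b],
   each point of which agrees at [a] with a point of [X]. *)
have [b [h hb]] := p_lift a.
have [/generates_uniformityP[_ ob] _ _] := fcov b.
apply: filterS (ob _ (bonding_unif_continuous h entEa)) => _ [[u v] /= uv <-].
have [[x xu] [y yv]] := (hb u, hb v).
exists (x, y); first by apply: EaE; rewrite /pull /= xu yv.
by rewrite /= !(fE a) xu yv !fac.
Qed.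

Lemma lim_covering_chain_lifting : chain_lifting f.
Proof.
apply/chain_liftingP => E entE.
have [a [Ea [entEa EaE]]] := pull_basis entE.
have [b [h hb]] := p_lift a.
have [_ /chain_liftingP lb _] := fcov b.
have [F entF FE] := lb _ (bonding_unif_continuous h entEa).
exists (pull F); first exact: entourage_pull.
move=> x y [[z w] /= zw [fzx fwy]].
have [|v xv fv] := FE (p b x) y.
  by exists (p b z, p b w); rewrite //= -!fE fzx fwy.
(* [x'] matches [v] only at the coordinate [a]; this suffices, since closeness is tested there and
   compatibility lets [f x'] be computed there. *)
have [x' x'v] := hb v; exists x'; last by rewrite (fE a) x'v fac.
by apply: EaE; rewrite /pull /= x'v -(p_bonding h).
Qed.

Lemma lim_covering_strong_approx_uniqueness :
  strong_approx_uniqueness_of_chain_lifts f.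
Proof.
apply/strong_approx_uniqueness_of_chain_liftsP => E entE.
have [a [Ea [entEa EaE]]] := pull_basis entE.
have [_ _ /uniqueness_of_chain_liftsP ua] := fcov a.
have [F [entF FEa uF]] := ua _ entEa.
exists (pull F); split; first exact: entourage_pull.
  by apply: subset_trans EaE => xy /FEa.
move=> x x' y z; rewrite /pull /= !(fE a) => xx' fxx' xy x'z fyz.
(* [x] and [x'] have the same coordinate at [a], so both steps leave one point of [sys_space a] and,
   by uniqueness, end at one point. *)
have pxx' := uF _ _ _ (entourage_refl _ entF) xx' fxx'.
rewrite -pxx' in x'z; rewrite (uF _ _ _ xy x'z fyz).
exact: entourage_refl.
Qed.

Lemma lim_covering_complete_fibers : complete_fibers f.
Proof.
move=> y F FF /cauchyP cF.
have fz (z : set_type (f @^-1` [set y])) : f (val z) = y := set_valP z.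
have /(_ _)/cid-/all_sig[t ht] a :
    exists t, exists2 A, F A & forall z, A z -> p a (val z) = t.
  have [G entG uG] := separating a.
  have [|A FA AG] := cF [set q | pull G (val q.1, val q.2)].
    by exists (pull G) => //; exact: entourage_pull.
  have [x Ax] := filter_ex FA; exists (p a (val x)), A => // z Az.
  by apply: (uG _ _ _ (entourage_refl _ entG) (AG _ _ Az Ax)); rewrite -!fE !fz.
have [|x xt] := thread_lift (t := t).
  move=> b a h; have [[A FA At] [B FB Bt]] := (ht a, ht b).
  (* Two sets of a proper filter meet, and the coordinates of a common point are compatible. *)
  by have [z [/At <- /Bt <-]] := filter_ex (filterI FA FB); exact: p_bonding.
have fx : f x = y.
  have a := dir_point S; have [A FA At] := ht a.
  by have [z /At zt] := filter_ex FA; rewrite -(fz z) !(fE a) xt zt.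
exists (exist _ x (mem_set fx)) => A.
rewrite -nbhs_entourageE => -[E [V entV VE] EA].
have [a [Ea [entEa EaV]]] := pull_basis entV.
have [B FB Bt] := ht a; apply: filterS FB => z /Bt zt.
apply: EA; apply/xsectionP; apply: VE; apply: EaV.
by rewrite /pull /= xt -zt; exact: entourage_refl.
Qed.
End limit_of_coverings.

(** * Symmetric entourages stable under lifting *)

Record stable_entourage (X Y : uniformType) (f : X -> Y) := StableEntourage {
  stable_set :> set (X * X);
  stable_entourageP : entourage stable_set;
  stable_sym : forall x y, stable_set (x, y) -> stable_set (y, x);
  stable_lift : lift_stable f stable_set
}.

Section stable_entourages.
Variables (X Y : uniformType) (f : X -> Y).

(** Transparent, as is the intersection below, so that later inclusions can be checked by computing
    the underlying set. *)
Definition stable_entourageT : stable_entourage f.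
Proof. by exists setT => //; exact: entourageT. Defined.

Definition stable_entourageI (F G : stable_entourage f) : stable_entourage f.
Proof.
exists (F `&` G).
- by apply: filterI; exact: stable_entourageP.
- by move=> x y [xyF xyG]; split; exact: stable_sym.
- move=> a a' b c [aaF aaG] faa' [abF abG] [acF acG] fbc.
  by split; [exact: (stable_lift aaF)|exact: (stable_lift aaG)].
Defined.

(** A lift-stable [F] is made symmetric by intersecting it with its inverse; stability survives
    because exchanging the two steps also puts [(c, b)] in [F]. *)
Lemma stable_entourage_sub (E : set (X * X)) :
  strong_approx_uniqueness_of_chain_lifts f -> entourage E ->
  exists F : stable_entourage f, F `<=` E.
Proof.
move=> /strong_approx_uniqueness_of_chain_liftsP uf /uf[F [entF FE sF]].
have entFI : entourage (F `&` F^-1)%relation by exact: entourage_invI.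
have symFI x y : (F `&` F^-1)%relation (x, y) -> (F `&` F^-1)%relation (y, x).
  by case.
have stFI : lift_stable f (F `&` F^-1)%relation.
  move=> a a' b c [/= aa' a'a] faa' [/= ab ba] [/= a'c ca'] fbc.
  by split; [exact: sF aa' _ ab a'c _|exact: sF a'a _ a'c ab _].
by exists (StableEntourage entFI symFI stFI) => xy [/= /FE].
Qed.

End stable_entourages.

(* The lifting hypothesis is a parameter of the type because the uniform
   structure below depends on it. *)
Definition quot_space (X Y : uniformType) (f : X -> Y) (lf : chain_lifting f)
    (F : stable_entourage f) : Type :=
  {A : set X | exists x, A = [set y | f x = f y /\ stable_set F (x, y)]}.

(** * The quotients as uniform coverings of [Y] *)

Section quotient_space.
Local Open Scope relation_scope.
Variables (X Y : uniformType) (f : X -> Y) (lf : chain_lifting f).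
Implicit Types F G K : stable_entourage f.
Notation Q := (quot_space lf).

Definition quot_proj F (x : X) : Q F := exist _ _ (ex_intro _ x erefl).

(** Lift stability with [a = a'] says that two points of one fiber that are [F]-close to a common
    point are [F]-close to each other; with symmetry this makes classes of related points equal. *)
Lemma quot_projP F x y :
  quot_proj F x = quot_proj F y <-> f x = f y /\ stable_set F (x, y).
Proof.
have Fxx z : stable_set F (z, z).
  by apply: entourage_refl; exact: stable_entourageP.
split=> [[xy]|[fxy xy]].
  by have : [set z | f y = f z /\ stable_set F (y, z)] y by []; rewrite -xy.
apply: eq_exist; apply/seteqP; split=> z [fz xz].
  have fyz : f y = f z by rewrite -fxy.
  by split=> //; exact: stable_lift (Fxx x) _ xy xz fyz.
have fxz : f x = f z by rewrite fxy.
by split=> //; exact: stable_lift (Fxx y) _ (stable_sym xy) xz fxz.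
Qed.

Lemma quot_proj_surj F (u : Q F) : exists x, quot_proj F x = u.
Proof. by case: u => A hA; case: (hA) => x Ax; exists x; exact: eq_exist. Qed.

Definition quot_repr F (u : Q F) : X := projT1 (cid (quot_proj_surj u)).

Lemma quot_reprK F : cancel (@quot_repr F) (quot_proj F).
Proof. by move=> u; exact: (projT2 (cid (quot_proj_surj u))). Qed.

Definition quot_map F (u : Q F) : Y := f (quot_repr u).

Lemma quot_map_proj F x : quot_map (quot_proj F x) = f x.
Proof. by have /quot_projP[] := quot_reprK (quot_proj F x). Qed.

Definition quot_entourage F : set_system (Q F * Q F) :=
  filter_from (@entourage X) (pair_image (quot_proj F)).

Let quot_entourage_filter F : Filter (@quot_entourage F).
Proof.
apply: filter_from_filter; first by exists setT; exact: entourageT.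
move=> E D entE entD; exists (E `&` D); first exact: filterI.
by move=> _ [p [Ep Dp] <-]; split; exists p.
Qed.

Let quot_entourage_diagonal F (D : set (Q F * Q F)) :
  quot_entourage D -> diagonal `<=` D.
Proof.
move=> [E entE ED] [u v] /diagonalP <-; rewrite -(quot_reprK u); apply: ED.
by exists (quot_repr u, quot_repr u) => //; exact: entourage_refl.
Qed.

Let quot_entourage_inv F (D : set (Q F * Q F)) :
  quot_entourage D -> quot_entourage D^-1.
Proof.
move=> [E entE ED]; exists E^-1; first exact: entourage_inv.
by move=> _ [[x y] Exy <-]; apply: ED; exists (y, x).
Qed.

(* Given (a, b), (b', c) with b ~ b', the pair (f b', f c) lifts to a pair
   (b, c'') with c'' ~ c, and (a, b), (b, c'') compose in X. *)
Let quot_entourage_split F (D : set (Q F * Q F)) : quot_entourage D ->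
  exists2 B, quot_entourage B & B \; B `<=` D.
Proof.
move=> [E entE ED]; set E1 := split_ent E.
have entE1F : entourage (E1 `&` F).
  by apply: filterI; [exact: entourage_split_ent|exact: stable_entourageP].
have [L entL LE] := (chain_liftingP f).1 lf _ entE1F.
exists (pair_image (quot_proj F) ((E1 `&` F) `&` L)).
  by exists ((E1 `&` F) `&` L) => //; exact: filterI.
move=> [u w] [v [[a b] /= [[ab _] _] [<- bv]]].
move=> [[b' c] /= [[_ b'c] Lb'c] [b'v <-]].
have /quot_projP[fbb' bb'] : quot_proj F b = quot_proj F b' by rewrite bv b'v.
have [|c' [bc' Fbc'] fc'] := LE b (f c).
  by exists (b', c); rewrite //= fbb'.
apply: ED; exists (a, c'); first exact: entourage_split ab bc'.
congr (_, _); apply/quot_projP; split => //.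
exact: stable_lift bb' fbb' Fbc' b'c fc'.
Qed.

HB.instance Definition _ F := gen_eqMixin (Q F).
HB.instance Definition _ F := gen_choiceMixin (Q F).
HB.instance Definition _ F := @isUniform.Build (Q F) (@quot_entourage F)
  (@quot_entourage_filter F) (@quot_entourage_diagonal F)
  (@quot_entourage_inv F) (@quot_entourage_split F).

Lemma quot_proj_entourage F E :
  entourage E -> entourage (pair_image (quot_proj F) E).
Proof. by move=> entE; exists E. Qed.

(** As [f] factors through the quotient, generation and lifting for [quot_map] reduce to those for
    [f]. *)
Lemma quot_map_image F E :
  pair_image (@quot_map F) (pair_image (quot_proj F) E) = pair_image f E.
Proof.
rewrite /pair_image image_comp; apply: eq_imagel => p _ /=.
by rewrite !quot_map_proj.
Qed.

Lemma quot_map_generates F :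
  generates_uniformity f -> generates_uniformity (@quot_map F).
Proof.
move=> gf; apply/seteqP; split=> G; rewrite gf.
  move=> [E entE EG]; exists (pair_image (quot_proj F) E).
    exact: quot_proj_entourage.
  by rewrite quot_map_image.
move=> [D [E entE ED] DG]; exists E => //; rewrite -(quot_map_image F).
by apply: subset_trans DG; exact: image_subset.
Qed.

Lemma quot_map_chain_lifting F : chain_lifting (@quot_map F).
Proof.
apply/chain_liftingP => D [E entE ED].
have [L entL LE] := (chain_liftingP f).1 lf _ entE.
exists (pair_image (quot_proj F) L); first exact: quot_proj_entourage.
(* [quot_map u] is by definition [f (quot_repr u)], so the lift under [f] starts at the
   representative of [u]. *)
move=> u y; rewrite quot_map_image => /LE[x' xx' <-].
exists (quot_proj F x'); last exact: quot_map_proj.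
by apply: ED; exists (quot_repr u, x') => //=; rewrite quot_reprK.
Qed.

(** Cutting down to [F] turns approximate uniqueness into equality: steps from equivalent points to
    one fiber end in equivalent points, that is, in one class. *)
Lemma quot_map_uniqueness F : uniqueness_of_chain_lifts (@quot_map F).
Proof.
apply/uniqueness_of_chain_liftsP => D [E entE ED].
exists (pair_image (quot_proj F) (E `&` F)); split.
- by apply: quot_proj_entourage; apply: filterI => //; exact: stable_entourageP.
- by apply: subset_trans ED; apply: image_subset; exact: subIsetl.
move=> u v w [[a b] /= [_ ab] [au <-]] [[a' c] /= [_ a'c] [a'u <-]].
rewrite !quot_map_proj => fbc.
have /quot_projP[faa' aa'] : quot_proj F a = quot_proj F a' by rewrite au a'u.
by apply/quot_projP; split => //; exact: stable_lift aa' faa' ab a'c fbc.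
Qed.

Lemma quot_map_covering F :
  generates_uniformity f -> uniform_covering_map (@quot_map F).
Proof.
split; [exact: quot_map_generates|exact: quot_map_chain_lifting|].
exact: quot_map_uniqueness.
Qed.

(** * The inverse system of quotients *)

Definition quot_bonding G F (GF : G `<=` F) (u : Q G) : Q F :=
  quot_proj F (quot_repr u).

Lemma quot_bonding_proj G F (GF : G `<=` F) x :
  quot_bonding GF (quot_proj G x) = quot_proj F x.
Proof.
have /quot_projP[fx Gx] := quot_reprK (quot_proj G x).
by apply/quot_projP; split => //; exact: GF.
Qed.

Lemma quot_bonding_unif_continuous G F (GF : G `<=` F) :
  unif_continuous (quot_bonding GF).
Proof.
move=> D [E entE ED]; exists E => // _ [p Ep <-].
by apply: ED; exists p; rewrite //= !quot_bonding_proj.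
Qed.

Let quot_bonding_id F (h : F `<=` F) u : quot_bonding h u = u.
Proof. exact: quot_reprK. Qed.

Let quot_bonding_comp K G F (KG : K `<=` G) (GF : G `<=` F) (KF : K `<=` F) u :
  quot_bonding GF (quot_bonding KG u) = quot_bonding KF u.
Proof. by rewrite -(quot_reprK u) !quot_bonding_proj. Qed.

Let stable_directed F G : exists H : stable_entourage f, H `<=` F /\ H `<=` G.
Proof.
by exists (stable_entourageI F G); split; [exact: subIsetl|exact: subIsetr].
Qed.

Definition quot_system : inverse_system :=
  @InverseSystem (stable_entourage f) (fun G F => G `<=` F)
    (stable_entourageT f) (fun F => @subset_refl _ F)
    (fun K G F => @subset_trans _ G K F) stable_directed
    (fun F => Q F) quot_bonding quot_bonding_unif_continuous
    quot_bonding_id quot_bonding_comp.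

Let quot_thread_proj x (G F : quot_system) (h : dir_le G F) :
  bonding h (quot_proj G x) = quot_proj F x.
Proof. exact: quot_bonding_proj. Qed.

Definition quot_thread (x : X) : inverse_limit quot_system :=
  @InverseLimit quot_system (fun F => quot_proj F x)
    (fun G F h => quot_thread_proj x h).

Lemma quot_system_Mittag_Leffler : strong_Mittag_Leffler quot_system.
Proof.
(* Every class is a coordinate of the thread of its representative, so the limit projects onto each
   quotient and the index itself works. *)
move=> F; exists F, (dir_le_refl F) => _ [u _ <-].
by exists (quot_thread (quot_repr u)).
Qed.

Lemma quot_map_compatible :
  @compatible_maps quot_system Y (fun F => @quot_map F).
Proof. by move=> G F GF u; exact: quot_map_proj. Qed.

(** * [X] as the limit of its quotients *)

Hypothesis hX : hausdorff_space X.
Hypothesis uf : strong_approx_uniqueness_of_chain_lifts f.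
Hypothesis cf : complete_fibers f.

Let quot_thread_inj : injective quot_thread.
Proof.
move=> x y xy; apply: (hausdorff_entourageP X).1 => // E entE.
have [F FE] := stable_entourage_sub uf entE; apply: FE.
have /quot_projP[_ //] : quot_proj F x = quot_proj F y.
exact: (congr1 (fun t => lim_proj t (F : quot_system)) xy).
Qed.

(* The preimages of the coordinates of a thread are a Cauchy filter base on a
   fiber of f, and its limit represents the thread. *)
Let quot_thread_surj t : exists x, quot_thread x = t.
Proof.
(* The classes for [T] are whole fibers, so the coordinate of [t] at [T] singles out the fiber over
   [y] in which to work. *)
pose T := stable_entourageT f.
pose y := quot_map (lim_proj t (T : quot_system)).
have tF F x : quot_proj F x = lim_proj t (F : quot_system) -> f x = y.
  move=> xt; have FT : @dir_le quot_system F T by [].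
  have := quot_thread_proj x FT; rewrite xt lim_projP => tT.
  by rewrite /y tT quot_map_proj.
pose fib := set_type (f @^-1` [set y]).
have fibP (z : fib) : f (val z) = y := set_valP z.
pose A F : set fib :=
  [set z | quot_proj F (val z) = lim_proj t (F : quot_system)].
have A_sub G F : G `<=` F -> A G `<=` A F.
  move=> GF z zG.
  have := quot_thread_proj (val z) (GF : @dir_le quot_system G F).
  by rewrite zG lim_projP.
have A_neq0 F : A F !=set0.
  have [x xt] := quot_proj_surj (lim_proj t (F : quot_system)).
  by exists (exist _ x (mem_set (tF _ _ xt))).
pose FF := filter_from [set: stable_entourage f] A.
have FF_filter : Filter FF.
  apply: filter_fromT_filter; first by exists T.
  move=> F G; exists (stable_entourageI F G) => z Az.
  by split; apply: A_sub Az; [exact: subIsetl|exact: subIsetr].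
have FF_proper : ProperFilter FF by apply: filter_from_proper => F _.
have [|x FFx] := cf FF_proper.
  apply/cauchyP => D [E entE ED].
  have [F FE] := stable_entourage_sub uf entE.
  exists (A F); first by exists F.
  move=> z w Az Aw; apply: ED; apply: FE.
  have /quot_projP[_ //] : quot_proj F (val z) = quot_proj F (val w).
  by rewrite Az Aw.
exists (val x); apply: inverse_limit_eq => F.
have [G _ GF] : FF (xsection [set q | stable_set F (val q.1, val q.2)] x).
  apply: FFx; apply: nbhs_entourage.
  by exists (stable_set F) => //; exact: stable_entourageP.
(* Such a [z] represents the coordinate of [t] at [F] and, lying in [A G], is [F]-close to [x];
   hence [x] represents that coordinate too. *)
have [z zGF] := A_neq0 (stable_entourageI F G).
have <- : quot_proj F (val z) = lim_proj t (F : quot_system).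
  by apply: A_sub zGF; exact: subIsetl.
apply/quot_projP; split.
  by rewrite !fibP.
by apply/xsectionP/GF/(A_sub (stable_entourageI F G)) => //; exact: subIsetr.
Qed.

Lemma quot_thread_equivalence : uniform_equivalence quot_thread.
Proof.
pose g t := projT1 (cid (quot_thread_surj t)).
have gK : cancel g quot_thread.
  by move=> t; exact: (projT2 (cid (quot_thread_surj t))).
exists g; split => //.
- by move=> x; apply: quot_thread_inj; rewrite gK.
- move=> D [F [B [[E entE EB] BD]]]; apply: filterS entE => -[x y] xy.
  by apply: BD; apply: EB; exists (x, y).
- move=> E entE; have entE2 := entourage_split_ent (entourage_split_ent entE).
  have [F FE] := stable_entourage_sub uf entE2.
  exists F, (pair_image (quot_proj F) F); split.
    by apply: quot_proj_entourage; exact: stable_entourageP.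
  move=> [s t] [[a b] /= ab [as_ bt]].
  have /quot_projP[_ sa] : quot_proj F (g s) = quot_proj F a.
    by rewrite as_ -{2}(gK s).
  have /quot_projP[_ tb] : quot_proj F b = quot_proj F (g t).
    by rewrite bt -{1}(gK t).
  apply: (@entourage_split _ b) => //.
    by apply: (@entourage_split _ a); [exact: entourage_split_ent|exact: FE..].
  by apply: split_ent_subset; [exact: entourage_split_ent|exact: FE].
Qed.

End quotient_space.

Theorem theorem3p6 (X Y : uniformType) (f : X -> Y) (hY : hausdorff_space Y) :
  (exists (S : inverse_system) (fa : forall a : S, sys_space a -> Y),
     [/\ strong_Mittag_Leffler S,
         compatible_maps fa,
         forall a : S, uniform_covering_map (fa a)
       & exists2 Phi : X -> inverse_limit S,
           uniform_equivalence Phi & lim_map fa \o Phi = f])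
  <->
  [/\ hausdorff_space X,
      generates_uniformity f,
      chain_lifting f,
      strong_approx_uniqueness_of_chain_lifts f
    & complete_fibers f].
Proof.
split=> [[S [fa [ML fac fcov [Phi PhiE <-]]]]|[hX gf lf uf cf]].
  split.
  - exact: lim_covering_hausdorff hY fac fcov PhiE.
  - exact: lim_covering_generates.
  - exact: lim_covering_chain_lifting.
  - exact: lim_covering_strong_approx_uniqueness.
  - exact: lim_covering_complete_fibers.
exists (quot_system lf), (fun F => @quot_map _ _ _ lf F); split.
- exact: quot_system_Mittag_Leffler.
- exact: quot_map_compatible.
- by move=> F; exact: quot_map_covering.
- exists (quot_thread lf); first exact: quot_thread_equivalence.
  by apply/funext => x; exact: quot_map_proj.
Qed.
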